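(* Let $X$ be an infinite compact metrizable monothetic group and $Tx=ax$ a minimal rotation of $X$ (i.e. $a\in X$ and $\{a^n:n\in\mathbb Z\}$ is dense in $X$). Suppose $G$ is a (second countable) Lie group or a locally compact second countable abelian group. Then every continuous recurrent cocycle $f:X\to G$ over $(X,T)$ is continuously cohomologous to a cocycle taking values in an almost connected closed subgroup $H$ of $G$. In particular, there are no continuous ergodic cocycles over $(X,T)$ taking values in a Lie group with infinitely many connected components.
   Context: A continuous map $f:X\to G$ defines a $\mathbb Z$-cocycle by $f(n,x)=f(T^{n-1}x)\cdots f(Tx)f(x)$ for $n\ge 1$, $f(0,x)=e$, and $f(n,x)=f(-n,T^nx)^{-1}$ for $n<0$. The skew product is the $\mathbb Z$-action on $X\times G$ given by $T_f^n(x,g)=(T^nx,f(n,x)g)$. The cocycle $f$ is recurrent if for every nonempty open $O\subset X\times G$ there is an integer $n\ne0$ with $T_f^nO\cap O\neq\varnothing$. It is ergodic (as a $G$-valued cocycle) if $T_f$ on $X\times G$ is topologically ergodic: for all nonempty open $O_1,O_2\subset X\times G$ there is $n\in\mathbb Z$ with $T_f^nO_1\cap O_2\ne\varnothing$. Cocycles $f,\widehat f:X\to G$ are continuously cohomologous if there is a continuous $b:X\to G$ with $\widehat f(x)=b(Tx)^{-1}f(x)b(x)$ for all $x\in X$. A locally compact group $H$ with identity component $H^0$ is almost connected if $H/H^0$ is compact. *)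

(* Defs.v *)
From HB Require Import structures.
From mathcomp Require Import all_boot all_order all_algebra.
From mathcomp Require Import all_classical all_reals all_analysis.
Import numFieldNormedType.Exports.

Set Implicit Arguments.
Unset Strict Implicit.
Unset Printing Implicit Defensive.

Local Open Scope classical_set_scope.
Local Open Scope group_scope.

HB.mixin Record Group_isTopologicalGroup G & Group G & Topological G := {
  mulg_continuous : continuous (fun p : G * G => p.1 * p.2) ;
  invg_continuous : continuous (fun x : G => x^-1)
}.

#[short(type="topologicalGroupType")]
HB.structure Definition TopologicalGroup :=
  { G of Group G & Topological G & Group_isTopologicalGroup G }.

Definition metrizable (R : realType) (T : topologicalType) : Prop :=
  exists (M : metricType R) (h : T -> M) (k : M -> T),
    [/\ cancel h k, cancel k h, continuous h & continuous k].

Section Subgroups.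
Context (G : topologicalGroupType).
Implicit Type H : set G.

Definition is_subgroup H : Prop :=
  [/\ H 1, forall x y, H x -> H y -> H (x * y) & forall x, H x -> H x^-1].

Definition identity_component H : set G := connected_component H 1.

(* H is viewed as a type carrying the subspace topology; two elements are
   identified when their left cosets x H^0 coincide. *)
Definition same_coset H (x y : set_type H) : bool :=
  `[< [set set_val x * h | h in identity_component H] =
      [set set_val y * h | h in identity_component H] >].

Lemma same_coset_equiv H : equiv_class_of (@same_coset H).
Proof.
split=> [x|x y|y x z]; first exact/asboolP.
  by apply/asboolP/asboolP => ->.
by move=> /asboolP xy /asboolP yz; apply/asboolP; rewrite xy.
Qed.

Canonical same_coset_rel H := EquivRelPack (same_coset_equiv H).

Definition component_quotient H : topologicalType :=
  quotient_topology {eq_quot same_coset_rel H}%qT.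

Definition almost_connected H : Prop := compact [set: component_quotient H].

End Subgroups.

Definition lcsc_abelian (G : topologicalGroupType) : Prop :=
  [/\ hausdorff_space G, locally_compact [set: G], @second_countable G
    & forall x y : G, x * y = y * x].

Section LieGroups.
Context (R : realType).

(* On an open subset of a finite-dimensional space this is the usual class
   C^k: f is C^(k+1) iff it is differentiable and all its directional
   derivatives are C^k. *)
Fixpoint Ck (V W : normedModType R) (k : nat) (U : set V) (f : V -> W) : Prop :=
  if k is m.+1 then
    (forall x, U x -> differentiable f x) /\
    (forall v : V, Ck m U (fun x => 'D_v f x : W))
  else forall x, U x -> {for x, continuous f}.

Definition smooth (V W : normedModType R) (U : set V) (f : V -> W) : Prop :=
  forall k, Ck k U f.

(* Values of chart_map outside chart_dom, and of chart_inv outside the image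
   of chart_dom, are irrelevant. The dimension n = 0 is allowed. *)
Record chart (G : topologicalType) (n : nat) := Chart {
  chart_dom : set G ;
  chart_map :> G -> 'rV[R]_n ;
  chart_inv : 'rV[R]_n -> G
}.

Definition chart_img (G : topologicalType) n (c : chart G n) : set 'rV[R]_n :=
  c @` chart_dom c.

Definition is_chart (G : topologicalType) n (c : chart G n) : Prop :=
  [/\ open (chart_dom c), open (chart_img c),
      forall x, chart_dom c x -> chart_inv c (c x) = x,
      {within chart_dom c, continuous c}
    & {within chart_img c, continuous (chart_inv c)}].

Definition smooth_atlas (G : topologicalType) n (A : set (chart G n)) : Prop :=
  [/\ forall c, A c -> is_chart c,
      forall x, exists2 c, A c & chart_dom c x
    & forall c d, A c -> A d ->
        smooth (c @` (chart_dom c `&` chart_dom d)) (d \o chart_inv c)].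

Definition smooth_mul (G : topologicalGroupType) n (A : set (chart G n)) :=
  forall c d e, A c -> A d -> A e ->
    smooth
      [set p : 'rV[R]_n * 'rV[R]_n | [/\ chart_img c p.1, chart_img d p.2
         & chart_dom e (chart_inv c p.1 * chart_inv d p.2)]]
      (fun p => e (chart_inv c p.1 * chart_inv d p.2)).

Definition smooth_inv (G : topologicalGroupType) n (A : set (chart G n)) :=
  forall c d, A c -> A d ->
    smooth
      [set u | chart_img c u /\ chart_dom d (chart_inv c u)^-1]
      (fun u => d (chart_inv c u)^-1).

Definition lie_group (G : topologicalGroupType) : Prop :=
  [/\ hausdorff_space G, @second_countable G
    & exists (n : nat) (A : set (chart G n)),
        [/\ smooth_atlas A, smooth_mul A & smooth_inv A]].

End LieGroups.

Definition infinitely_many_components (G : topologicalType) : Prop :=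
  infinite_set (range (connected_component [set: G])).

Definition expgz (G : groupType) (a : G) (n : int) : G :=
  match n with Posz m => a ^+ m | Negz m => a ^- m.+1 end.

Definition rotation (X : groupType) (a : X) (n : int) (x : X) : X :=
  expgz a n * x.

(* act n is the n-th power T^n of the transformation T = act 1. *)
Section Cocycles.
Context (X : topologicalType) (G : topologicalGroupType).
Variables (act : int -> X -> X) (f : X -> G).

Fixpoint cocycle_nat (n : nat) (x : X) : G :=
  if n is m.+1 then f (act m x) * cocycle_nat m x else 1.

Definition cocycle (n : int) (x : X) : G :=
  match n with
  | Posz m => cocycle_nat m x
  | Negz m => (cocycle_nat m.+1 (act (Negz m) x))^-1
  end.

Definition skew_product (n : int) (p : X * G) : X * G :=
  (act n p.1, cocycle n p.1 * p.2).

Definition recurrent : Prop :=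
  forall O : set (X * G), open O -> O !=set0 ->
    exists2 n : int, n != 0%R & (skew_product n @` O) `&` O !=set0.

Definition ergodic : Prop :=
  forall O1 O2 : set (X * G), open O1 -> O1 !=set0 -> open O2 -> O2 !=set0 ->
    exists n : int, (skew_product n @` O1) `&` O2 !=set0.

Definition cohomologous (f' : X -> G) : Prop :=
  exists2 b : X -> G, continuous b &
    forall x, f' x = (b (act 1%R x))^-1 * f x * b x.

End Cocycles.

(* Main.v *)
(* Let N be an open normal subgroup of G. Modulo N the cocycle f is locally
   constant, so by compactness it is invariant under right translation by an
   open subgroup V of X, i.e. it is a cocycle over a rotation of the finite
   cyclic X / V. Recurrence provides n > 0 with a ^+ n in V and f(n, 1) in N,
   so that f(-, 1) is n-periodic modulo N; hence f is cohomologous, through a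
   locally constant transfer function, to a cocycle with values in a finite
   union H of cosets of N. It remains to find N almost connected: the identity
   component G^0 for Lie groups, and for abelian G the preimage of a compact
   open subgroup of the totally disconnected group G / G^0.
   Ergodicity implies recurrence because X has no isolated point, and it forces
   H = G, which for N = G^0 leaves only finitely many components. *)
Require Import Defs.
From HB Require Import structures.
From mathcomp Require Import all_boot all_order all_algebra.
From mathcomp Require Import all_classical all_reals all_analysis.
Import Order.TTheory GRing.Theory Num.Theory numFieldNormedType.Exports.

Local Open Scope classical_set_scope.

Set Implicit Arguments.
Unset Strict Implicit.
Unset Printing Implicit Defensive.

Local Open Scope group_scope.

(** * Open subgroups, and congruence modulo a normal subgroup *)

Definition normalized (G : groupType) (N : set G) :=
  forall g x, N x -> N (g^-1 * x * g).

Definition eqmod (G : groupType) (N : set G) (x y : G) := N (x^-1 * y).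

Section OpenSubgroups.
Context (G : topologicalGroupType).
Implicit Types (N : set G) (x y : G).

Lemma cvg_mulg T (F : set_system T) (FF : Filter F) (u v : T -> G) (p q : G) :
  u @ F --> p -> v @ F --> q -> (fun t => u t * v t : G) @ F --> p * q.
Proof. by move=> up vq; apply: continuous2_cvg => //; exact: (mulg_continuous (p, q)). Qed.

Lemma cvg_invg T (F : set_system T) (FF : Filter F) (u : T -> G) (p : G) :
  u @ F --> p -> (fun t => (u t)^-1 : G) @ F --> p^-1.
Proof. by move=> up; apply: (@continuous_cvg _ G G _ _ u) => //; exact: invg_continuous. Qed.

Lemma nbhs1_mulg x N : nbhs 1 N -> \forall y \near x, N (x^-1 * y).
Proof.
move=> N1; have : (fun y => x^-1 * y) @ x --> x^-1 * x.
  by apply: cvg_mulg; [exact: cvg_cst|exact: cvg_id].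
by rewrite mulVg; apply.
Qed.

Lemma open_subgroup N : is_subgroup N -> nbhs 1 N -> open N.
Proof.
move=> [_ NM _] N1; rewrite openE => x Nx; rewrite /interior /=.
by apply: filterS (nbhs1_mulg x N1) => y Ny; rewrite -(mulVKg x y); exact: NM.
Qed.

Lemma open_subgroup_closed N : is_subgroup N -> open N -> closed N.
Proof.
move=> [N1 NM NV] oN x /(_ [set y | N (x^-1 * y)]) []; first exact/nbhs1_mulg/open_nbhs_nbhs.
by move=> y [Ny /NV]; rewrite invgM invgK => /(NM _ _ Ny); rewrite mulVKg.
Qed.

End OpenSubgroups.

Section Eqmod.
Context (G : groupType) (N : set G).
Hypotheses (N1 : N 1) (NM : forall x y, N x -> N y -> N (x * y))
  (NV : forall x, N x -> N x^-1) (nN : normalized N).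
Local Notation "x == y" := (eqmod N x y).

Lemma eqmod_refl x : x == x.
Proof. by rewrite /eqmod mulVg. Qed.

Lemma eqmod_sym x y : x == y -> y == x.
Proof. by move=> /NV; rewrite invgM invgK. Qed.

Lemma eqmod_trans y x z : x == y -> y == z -> x == z.
Proof. by move=> xy yz; have := NM xy yz; rewrite /eqmod mulgA mulgK. Qed.

Lemma eqmodM x x' y y' : x == x' -> y == y' -> x * y == x' * y'.
Proof.
move=> xx yy; have := NM (nN y xx) yy.
by rewrite /eqmod !mulgA mulgK invgM.
Qed.

Lemma eqmodV x y : x == y -> x^-1 == y^-1.
Proof.
move=> /eqmod_sym xy; have := nN y^-1 xy.
by rewrite /eqmod !invgK mulVKg.
Qed.

Lemma eqmod1 x : x == 1 <-> N x.
Proof. by rewrite /eqmod mulg1; split=> /NV; rewrite ?invgK. Qed.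

Lemma eqmod_mem x y : x == y -> N x -> N y.
Proof. by move=> xy Nx; rewrite -(mulVKg x y); exact: NM. Qed.

End Eqmod.

(** * Recurrent cocycles modulo an open normal subgroup *)

Section CocycleNat.
Context (X G : topologicalGroupType) (a : X) (f : X -> G).
Local Notation cn := (cocycle_nat (rotation a) f).

Lemma cocycle_natD m n x : cn (m + n) x = cn m (a ^+ n * x) * cn n x.
Proof.
elim: m => [|m IHm] /=; first by rewrite mul1g.
by rewrite IHm mulgA /rotation /= expgnDr mulgA.
Qed.

End CocycleNat.

Section RecurrentCocycle.
Context (X G : topologicalGroupType) (a : X) (f : X -> G) (N : set G).
Hypotheses (X_compact : compact [set: X]) (a_dense : dense (range (expgz a))).
Hypotheses (N_group : is_subgroup N) (nN : normalized N) (oN : open N).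
Hypotheses (cf : continuous f) (rf : recurrent (rotation a) f).

Local Notation cn := (cocycle_nat (rotation a) f).
Local Notation F j := (cn j 1).
Local Notation "x == y" := (eqmod N x y).

Let N1 : N 1. Proof. by case: N_group. Qed.
Let NM x y : N x -> N y -> N (x * y). Proof. by case: N_group => _ + _; exact. Qed.
Let NV x : N x -> N x^-1. Proof. by case: N_group => _ _; exact. Qed.
Let eqr x : x == x. Proof. exact: eqmod_refl. Qed.
Let eqs x y : x == y -> y == x. Proof. exact: eqmod_sym. Qed.
Let eqt y x z : x == y -> y == z -> x == z. Proof. exact: eqmod_trans. Qed.
Let eqM x x' y y' : x == x' -> y == y' -> x * y == x' * y'.
Proof. exact: eqmodM. Qed.
Let eqV x y : x == y -> x^-1 == y^-1. Proof. exact: eqmodV. Qed.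

(** The translations are on the right so that they commute with the rotation, which multiplies on
    the left. *)
Definition period : set X := [set v | forall x, f x == f (x * v)].
Local Notation V := period.

Lemma period_subgroup : is_subgroup V.
Proof.
split=> [x|u v uV vV x|u uV x]; first by rewrite mulg1.
  by rewrite mulgA; exact: eqt (uV x) (vV _).
by have := uV (x * u^-1); rewrite mulgVK; exact: eqs.
Qed.

Let V1 : V 1. Proof. by case: period_subgroup. Qed.
Let VM x y : V x -> V y -> V (x * y). Proof. by case: period_subgroup => _ + _; exact. Qed.
Let VV x : V x -> V x^-1. Proof. by case: period_subgroup => _ _; exact. Qed.
Let VX x n : V x -> V (x ^+ n).
Proof. by move=> Vx; elim: n => // n IHn; rewrite expgS; exact: VM. Qed.

(** By continuity the congruence holds for all pairs near (x, 1); compactness of [X] makes the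
    neighbourhood of 1 uniform in x. *)
Lemma period_nbhs : nbhs 1 V.
Proof.
have cX : near_covering [set: X] by apply/compact_near_coveringP.
suff W : \forall v \near nbhs (1 : X), [set: X] `<=` (fun x => f x == f (x * v)).
  by apply: filterS W => v Vv x; exact: Vv.
apply: (cX _ _ (fun v x => f x == f (x * v))) => x _.
have : (fun p : X * X => (f p.1)^-1 * f (p.1 * p.2)) @ (x, 1) -->
       (f x)^-1 * f (x * 1).
  apply: cvg_mulg.
    by apply: cvg_invg; apply: (@continuous_cvg _ X G _ _ fst f); [exact: cf|exact: cvg_fst].
  apply: (@continuous_cvg _ X G _ _ (fun p : X * X => p.1 * p.2) f); first exact: cf.
  by apply: cvg_mulg; [exact: cvg_fst|exact: cvg_snd].
rewrite mulg1 mulVg => /(_ N); apply; exact: open_nbhs_nbhs.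
Qed.

Lemma period_open : open V.
Proof. exact: open_subgroup period_subgroup period_nbhs. Qed.

Lemma cocycle_period j x v : V v -> cn j x == cn j (x * v).
Proof.
move=> Vv; elim: j => [|j IHj] //=.
by apply: eqM IHj; rewrite /rotation mulgA; exact: Vv.
Qed.

Lemma cocycle_period2 j x y : V (x^-1 * y) -> cn j x == cn j y.
Proof. by move=> /(cocycle_period j x); rewrite mulVKg. Qed.

(** Recurrence is applied to the open set V x N. A negative return time is reversed: the cocycle
    there is the inverse of a positive-time value, and V and N are closed under inverses. *)
Lemma return_time : exists n, [/\ (0 < n)%N, V (a ^+ n) & N (F n)].
Proof.
have oVN : open (V `*` N).
  rewrite openE => -[x g] [Vx Ng]; exists (V, N) => //; split.
    by apply: open_nbhs_nbhs; split=> //; exact: period_open.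
  exact: open_nbhs_nbhs.
have [|i i0 [_ [[[x g] [/= Vx Ng] <-]] [/= Va Nf]]] := rf oVN.
  by exists (1, 1).
have /= {Ng}Nf : N (cocycle (rotation a) f i x).
  by have := NM Nf (NV Ng); rewrite mulgK.
have {}Va : V (expgz a i) by have := VM Va (VV Vx); rewrite /rotation mulgK.
case: i => [n|n] /= in i0 Va Nf *.
  exists n; split=> //; first by case: n i0 {Va Nf}.
  by apply: (eqmod_mem NM) Nf; apply: cocycle_period2; rewrite mulg1; exact: VV.
exists n.+1; split=> //; first by have := VV Va; rewrite invgK.
have := NV Nf; rewrite invgK; apply: (eqmod_mem NM).
apply: (@cocycle_period2 n.+1); rewrite mulg1 /rotation /= invgM.
by apply: VM; exact: VV.
Qed.

(** The coset x V is open, so density puts some power of [a] in it; a multiple of the return time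
    then makes the exponent nonnegative. *)
Lemma dense_nat x : exists k, V ((a ^+ k)^-1 * x).
Proof.
have [n [n0 Vn _]] := return_time.
have nVn k : V (a ^+ (n * k)) by rewrite expgnA; exact: VX.
have oVx : open [set y | V (y^-1 * x)].
  rewrite openE => y Vyx; rewrite /interior /=.
  apply: filterS (nbhs1_mulg y period_nbhs) => z Vz /=.
  by have := VM (VV Vz) Vyx; rewrite invgM invgK mulgA mulgK.
have [|y [/= Vy [i _ iy]]] := @a_dense _ _ oVx.
  by exists x; rewrite /= mulVg.
move: Vy; rewrite -{y}iy; case: i => k /= Vy; first by exists k.
(* This exponent is [- k.+1] plus [n * k.+1], a multiple of the return time. *)
rewrite invgK in Vy; exists (n.-1 * k.+1)%N.
have := VM (VV (nVn k.+1)) Vy.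
by rewrite -[n in (n * _)%N](prednK n0) mulSn expgnDr invgM mulgA mulgVK.
Qed.

(** The target group H, a union of cosets of N. Only times j that return to V are allowed, since on
    these j -> [F j] is multiplicative modulo N. *)
Definition return_group : set G := [set g | exists2 j, V (a ^+ j) & F j == g].
Local Notation H := return_group.

Lemma cocycleD i j : V (a ^+ i) -> F (j + i) == F j * F i.
Proof.
move=> Vi; rewrite cocycle_natD; apply: eqM (eqr _).
by apply: cocycle_period2; rewrite !mulg1; exact: VV.
Qed.

Lemma cocycle_mul_mem n k : V (a ^+ n) -> N (F n) -> N (F (n * k)).
Proof.
move=> Vn Nn; elim: k => [|k IHk]; first by rewrite muln0.
rewrite mulnS; apply: (eqmod_mem NM) (NM Nn IHk); apply: eqs; apply: cocycleD.
by rewrite expgnA; exact: VX.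
Qed.

Lemma return_group_subgroup : is_subgroup H.
Proof.
have [n [n0 Vn Nn]] := return_time.
split=> [|x y [i Vi ix] [j Vj jy]|x [j Vj jx]].
- by exists 0%N.
- exists (i + j)%N; first by rewrite expgnDr; exact: VM.
  exact: eqt (cocycleD _ Vj) (eqM ix jy).
(* The time [n.-1 * j] complements j to [n * j], where [F] is trivial modulo N. *)
- exists (n.-1 * j)%N; first by rewrite mulnC expgnA; exact: VX.
  apply: eqt (eqV jx).
  have : F (n.-1 * j) * F j == 1.
    apply: eqt (eqs (cocycleD _ Vj)) _; apply/(eqmod1 NV).
    by rewrite addnC -mulSn prednK //; exact: cocycle_mul_mem.
  by move=> /eqM/(_ (eqr (F j)^-1)); rewrite mulgK mul1g.
Qed.

Lemma return_group_sup : N `<=` H.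
Proof. by move=> g Ng; exists 0%N => //; rewrite /eqmod /= invg1 mul1g. Qed.

(** Modulo N the sequence [F] is n-periodic for a return time n, so the remainders modulo n already
    give all cosets. *)
Lemma return_group_finite :
  exists n, forall g, H g -> exists2 i, (i < n)%N & F i == g.
Proof.
have [n [n0 Vn Nn]] := return_time; exists n => g [j Vj jg].
exists (j %% n)%N; first by rewrite ltn_mod.
apply: eqt jg; apply: eqs; rewrite {1}(divn_eq j n) addnC mulnC.
apply: eqt (cocycleD _ _) _; first by rewrite expgnA; exact: VX.
rewrite -[X in _ == X]mulg1; apply: eqM (eqr _) _; apply/(eqmod1 NV).
exact: cocycle_mul_mem.
Qed.

(** The choice depends on x only through a set that is the same for all points of x V, which makes
    it locally constant. By [dense_nat] the set is never empty, so the default 0 is not taken. *)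
Definition transfer_time x : nat := xget 0%N [set k | V ((a ^+ k)^-1 * x)].
Local Notation k := transfer_time.

Lemma transfer_timeP x : V ((a ^+ k x)^-1 * x).
Proof. exact: (@xgetPex _ 0%N [set j | V ((a ^+ j)^-1 * x)] (dense_nat x)). Qed.

Lemma transfer_time_period x y : V (x^-1 * y) -> k x = k y.
Proof.
move=> Vxy; congr xget; apply/seteqP; split=> j /= Vj.
  by have := VM Vj Vxy; rewrite mulgA mulgK.
by have := VM Vj (VV Vxy); rewrite invgM invgK mulgA mulgK.
Qed.

(** Along the orbit of 1 the function sending [a ^+ k] to [F k] would trivialise f exactly. Choosing
    k from the class of x modulo V makes it locally constant, at the price of an error in H. *)
Definition transfer x : G := F (k x).

Lemma transfer_continuous : continuous transfer.
Proof.
move=> x; apply: cvg_near_cst.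
apply: filterS (nbhs1_mulg x period_nbhs) => y Vy.
by rewrite /transfer (transfer_time_period Vy).
Qed.

Lemma transferP x : H ((transfer (rotation a 1 x))^-1 * f x * transfer x).
Proof.
rewrite /transfer /rotation /= expg1.
have Vi := transfer_timeP x; have Vi' := transfer_timeP (a * x).
move: (k x) (k (a * x)) Vi Vi' => i i' Vi Vi'.
have [n [n0 Vn Nn]] := return_time.
have Vii' : V ((a ^+ i')^-1 * a ^+ i.+1).
  by have := VM Vi' (VV Vi); rewrite invgM invgK expgS !mulgA mulgK.
(* Modulo N the element is [F i.+1] corrected by the inverse of [F i']. This time stands for
   [i.+1 - i'], made nonnegative by adding [i' * n], where [F] lies in N. *)
exists (i' * n.-1 + i.+1)%N.
  rewrite expgnDr -(mulVKg (a ^+ i') (a ^+ i.+1)) mulgA; apply: VM => //.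
  by rewrite -expgnDr -mulnSr prednK // mulnC expgnA; exact: VX.
have fx : F i.+1 == f x * F i.
  apply: eqM (eqr _); rewrite /rotation /= mulg1.
  by have := Vi; move=> /(_ (a ^+ i)); rewrite mulVKg.
have Fi' : (F i')^-1 == cn (i' * n.-1) (a ^+ i.+1).
  apply: (@eqt (cn (i' * n.-1) (a ^+ i'))); last exact: cocycle_period2.
  have : 1 == cn (i' * n.-1) (a ^+ i') * F i'.
    have := cocycle_natD a f (i' * n.-1) i' 1; rewrite mulg1 => <-.
    apply: eqs; apply/(eqmod1 NV).
    by rewrite -mulnSr prednK // mulnC; exact: cocycle_mul_mem.
  by move=> /eqM/(_ (eqr (F i')^-1)); rewrite mulgK mul1g.
rewrite cocycle_natD mulg1 -mulgA; apply: eqM fx; exact: eqs.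
Qed.

End RecurrentCocycle.

(** * The identity component, and compactness of the component quotient *)

Section IdentityComponent.
Context (G : topologicalGroupType).
Implicit Types (H K N : set G) (x y : G).
Local Notation L := (identity_component [set: G]).

Lemma continuous_conj x y : continuous (fun z : G => x * z * y : G).
Proof.
move=> z; apply: cvg_mulg; last exact: cvg_cst.
by apply: cvg_mulg; [exact: cvg_cst|exact: cvg_id].
Qed.

(** The two independent factors cover both conjugation and, with y = 1, left translation. *)
Lemma connected_conj x y (C : set G) :
  connected C -> connected [set x * z * y | z in C].
Proof.
move=> cC; apply: connected_continuous_connected => //.
exact/continuous_subspaceT/continuous_conj.
Qed.

(** For x in the component C, the translate of C by the inverse of x is connected, lies in H and
    contains 1, hence lies in C. *)
Lemma identity_component_subgroup H :
  is_subgroup H -> is_subgroup (identity_component H).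
Proof.
move=> [H1 HM HV].
have C1 : identity_component H 1 by exact: connected_component_refl.
have CVM x y : identity_component H x -> identity_component H y ->
    identity_component H (x^-1 * y).
  move=> Cx Cy; pose D := [set x^-1 * z * 1 | z in identity_component H].
  have D1 : D 1 by exists x => //; rewrite mulg1 mulVg.
  apply: (connected_component_max D1); last by exists y => //; rewrite mulg1.
    move=> _ [z /connected_component_sub Hz <-]; rewrite mulg1.
    by apply: HM => //; apply: HV; exact: connected_component_sub Cx.
  by apply: connected_conj; exact: component_connected.
have CV x : identity_component H x -> identity_component H x^-1.
  by move=> Cx; rewrite -[x^-1]mulg1; exact: CVM.
by split=> // x y Cx Cy; rewrite -[x]invgK; apply: CVM => //; exact: CV.
Qed.

Lemma identity_component_normalized : normalized L.
Proof.
move=> g x Lx; pose D := [set g^-1 * z * g | z in L].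
have D1 : D 1.
  exists 1; first exact: connected_component_refl.
  by rewrite mulg1 mulVg.
apply: (connected_component_max D1) => //; last by exists x.
by apply: connected_conj; exact: component_connected.
Qed.

Lemma identity_component_sub_clopen N : open N -> closed N -> N 1 -> L `<=` N.
Proof.
move=> oN cN N1; suff <- : L `&` N = L by exact: subIsetr.
apply: component_connected; [|by exists N|by exists N].
by exists 1; split=> //; exact: connected_component_refl.
Qed.

Lemma identity_component_sub H :
  L `<=` H -> identity_component H = L.
Proof.
move=> LH; have L1 : L 1 by exact: connected_component_refl.
apply/seteqP; split=> x; last first.
  apply: connected_component_max L1 LH _ x; exact: component_connected.
apply: connected_component_max => //; last exact: component_connected.
by apply: connected_component_refl; exact: LH.
Qed.

Lemma compact_subtype H K : compact K -> K `<=` H ->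
  compact (set_val @^-1` K : set (set_type H)).
Proof.
move=> /compact_near_coveringP cK KH; apply/compact_near_coveringP => I F P FF cP.
(* Quantifying over every z above x moves the covering property from the subtype to [G], where [K]
   is compact. *)
have : \forall i \near F, K `<=` [set x | forall z : set_type H,
    set_val z = x -> P i z].
  apply: (cK _ _ (fun i x => forall z : set_type H, set_val z = x -> P i z)).
  move=> x Kx.
  pose z : set_type H := SigSub (mem_set (KH _ Kx)).
  have [[A B] [/= [_ [[U oU <-] Uz UA] FB] AB]] := cP z Kx.
  exists (U, B) => /=; first by split=> //; exact: open_nbhs_nbhs.
  move=> [y i] /= [Uy Bi] w wy; apply: (AB (w, i)); split=> //=.
  by apply: UA => /=; rewrite wy.
by apply: filterS => i Pi z Kz; exact: Pi Kz _ erefl.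
Qed.

(** Each coset of the component of H has a representative in K, so the quotient is a continuous
    image of the compact K. *)
Lemma almost_connected_compact H K : is_subgroup H -> compact K -> K `<=` H ->
  (forall h, H h -> exists2 k, K k & identity_component H (k^-1 * h)) ->
  almost_connected H.
Proof.
move=> gH cK KH HK.
have [_ CM CV] := identity_component_subgroup gH.
rewrite /almost_connected; have -> : [set: component_quotient H] =
    (\pi_(component_quotient H))%qT @` (set_val @^-1` K).
  apply/seteqP; split=> // q _.
  have [k Kk Ckq] := HK _ (set_mem (valP (repr q))).
  exists (SigSub (mem_set (KH _ Kk))) => //.
  rewrite -[RHS]reprK; apply/eqmodP/asboolP.
  apply/seteqP; split=> _ [h Ch <-] /=.
    exists ((k^-1 * set_val (repr q))^-1 * h); first by apply: CM => //; exact: CV.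
    by rewrite invgM invgK !mulgA mulgV mul1g.
  by exists (k^-1 * set_val (repr q) * h); [exact: CM|rewrite !mulgA mulgV mul1g].
apply: continuous_compact; last exact: compact_subtype.
exact/continuous_subspaceT/pi_continuous.
Qed.

End IdentityComponent.

(* Van Dantzig's theorem for G / L, where L is the identity component, phrased
   in G with L-saturated sets. S plays the role of a compact neighbourhood of
   the identity in G / L, and [quasi E] says that E is a relatively clopen
   neighbourhood of the identity in it. *)
Section OpenAlmostConnectedSubgroup.
Context (G : topologicalGroupType) (K : set G).
Hypotheses (cK : compact K) (nK : nbhs 1 K).
Implicit Types (A B D E O : set G) (x y : G).
Local Notation L := (identity_component [set: G]).

Let gT : is_subgroup [set: G]. Proof. by []. Qed.
Let L1 : L 1. Proof. by case: (identity_component_subgroup gT). Qed.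
Let LM x y : L x -> L y -> L (x * y).
Proof. by case: (identity_component_subgroup gT) => _ + _; exact. Qed.
Let LV x : L x -> L x^-1.
Proof. by case: (identity_component_subgroup gT) => _ _; exact. Qed.
Let nL := @identity_component_normalized G.
Let cL : closed L. Proof. exact: component_closed closedT. Qed.

Let S := [set x | exists2 k, K k & L (k^-1 * x)].

Let S1 : S 1.
Proof. by exists 1; [exact: nbhs_singleton|rewrite mulVg]. Qed.

Definition saturated E := forall x l, L l -> E x -> E (x * l).

Lemma saturatedC E : saturated E -> saturated (~` E).
Proof. by move=> sE x l /LV Ll nEx /(sE _ _ Ll); rewrite mulgK. Qed.

Lemma saturatedI E D : saturated E -> saturated D -> saturated (E `&` D).
Proof. by move=> sE sD x l Ll [Ex Dx]; split; [exact: sE|exact: sD]. Qed.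

Lemma saturatedU E D : saturated E -> saturated D -> saturated (E `|` D).
Proof. by move=> sE sD x l Ll [Ex|Dx]; [left; exact: sE|right; exact: sD]. Qed.

Lemma saturatedS : saturated S.
Proof. by move=> x l Ll [k Kk Lx]; exists k => //; rewrite mulgA; exact: LM. Qed.

(** This lets compactness of [K] replace compactness in G / L: a saturated part of S is determined
    by its trace on [K]. *)
Lemma saturated_repr E x : saturated E -> S x -> E x ->
  exists k, [/\ K k, E k & L (k^-1 * x)].
Proof.
move=> sE [k Kk Lkx] Ex; exists k; split=> //.
by have := sE _ _ (LV Lkx) Ex; rewrite invgM invgK mulgA mulgV mul1g.
Qed.

Lemma closedS : closed S.
Proof.
rewrite -[S]setCK; apply: open_closedC; rewrite openE => x nSx.
have /compact_near_coveringP cK' := cK.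
have : \forall y \near x, K `<=` [set k | ~ L (k^-1 * y)].
  apply: (cK' _ _ (fun y k => ~ L (k^-1 * y))) => k Kk.
  have : (fun p : G * G => p.1^-1 * p.2) @ (k, x) --> k^-1 * x.
    apply: cvg_mulg; last exact: cvg_snd.
    by apply: cvg_invg; exact: cvg_fst.
  move=> /(_ (~` L)); apply; apply: open_nbhs_nbhs; split; first exact: closed_openC.
  by move=> Lkx; apply: nSx; exists k.
by apply: filterS => y Ky [k Kk]; exact: Ky.
Qed.

(** Compactness of the trace of A on [K] gives one neighbourhood of v for all its points k. For x =
    k l one has x v = k v (v^-1 l v), and the last factor is in L by normality. *)
Lemma tube A O : closed A -> saturated A -> A `<=` S -> open O -> saturated O ->
  A `<=` O -> \forall v \near (1 : G), forall x, A x -> O (x * v).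
Proof.
move=> cA sA AS oO sO AO.
have /compact_near_coveringP cKA : compact (K `&` A) by exact: compact_closedI.
have : \forall v \near (1 : G), K `&` A `<=` [set x | O (x * v)].
  apply: (cKA _ _ (fun v x => O (x * v))) => k [_ /AO Ok].
  have : (fun p : G * G => p.1 * p.2) @ (k, 1) --> k * 1.
    by apply: cvg_mulg; [exact: cvg_fst|exact: cvg_snd].
  by rewrite mulg1; apply; exact: open_nbhs_nbhs.
apply: filterS => v KAv x Ax; have [k [Kk Ak Lkx]] := saturated_repr sA (AS _ Ax) Ax.
have := sO _ _ (nL v Lkx) (KAv _ (conj Kk Ak)).
by rewrite !mulgA mulgK mulgV mul1g.
Qed.

Definition thicken A (W : set G) := [set x | exists2 y, A y & W (y^-1 * x)].

Lemma thicken_open A W : open W -> open (thicken A W).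
Proof.
move=> oW; rewrite openE => x [y Ay Wyx]; rewrite /interior /=.
have yx : (fun z => y^-1 * z : G) @ x --> y^-1 * x.
  by apply: cvg_mulg; [exact: cvg_cst|exact: cvg_id].
have : \forall z \near x, W (y^-1 * z) by apply: yx; exact: open_nbhs_nbhs.
by apply: filterS => z Wz; exists y.
Qed.

Lemma thicken_saturated A W : saturated A -> saturated (thicken A W).
Proof.
move=> sA x l Ll [y Ay Wyx]; rewrite -(mulVKg y x); move: (y^-1 * x) Wyx => w Ww.
exists (y * (w * l * w^-1)); first by apply: sA => //; have := nL w^-1 Ll; rewrite invgK.
by rewrite (_ : y * w * l = y * (w * l * w^-1) * w) ?mulKg // !mulgA mulgVK.
Qed.

Lemma sub_thicken A W : W 1 -> A `<=` thicken A W.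
Proof. by move=> W1 x Ax; exists x => //; rewrite mulVg. Qed.

Definition quasi E :=
  [/\ E 1, saturated E, closed E, E `<=` S & closed (S `\` E)].

Lemma quasiS : quasi S.
Proof. by split=> //; [exact: saturatedS|exact: closedS|rewrite setDv; exact: closed0]. Qed.

Lemma quasiI E D : quasi E -> quasi D -> quasi (E `&` D).
Proof.
move=> [E1 sE cE ES cSE] [D1 sD cD DS cSD]; split=> //.
- exact: saturatedI.
- exact: closedI.
- by move=> x [/ES].
- by rewrite setDIr; exact: closedU.
Qed.

(** Quasi sets are stable under finite intersection, so compactness of the trace of D on [K] merges
    the sets avoiding single points into one. *)
Lemma quasi_avoid D : closed D -> saturated D -> D `<=` S ->
  (forall x, D x -> exists2 E, quasi E & ~ E x) ->
  exists2 E, quasi E & E `<=` ~` D.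
Proof.
move=> cD sD DS DE.
have /compact_near_coveringP cKD : compact (K `&` D) by exact: compact_closedI.
(* Along this filter a quasi set eventually lies inside any given quasi set. *)
pose F := filter_from quasi (fun E => [set E' | quasi E' /\ E' `<=` E]).
have FF : Filter F.
  apply: filter_from_filter; first by exists S; exact: quasiS.
  move=> E E' qE qE'; exists (E `&` E'); first exact: quasiI.
  by move=> A [qA AE]; split; split=> // x /AE [].
have [|E qE EKD] := cKD _ F (fun E x => ~ E x) FF.
  move=> x [_ Dx]; have [E qE nEx] := DE x Dx.
  exists (~` E, [set E' | quasi E' /\ E' `<=` E]).
    split; last by exists E.
    apply: open_nbhs_nbhs; split=> //; apply: closed_openC.
    by case: qE.
  by move=> [y E'] /= [nEy [_ E'E]] /E'E.
exists E => // x Ex Dx; have [k [Kk Dk Lkx]] := saturated_repr sD (DS _ Dx) Dx.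
apply: (EKD E _ k); [by split|by split|].
have [_ sE _ _ _] := qE.
by have := sE _ _ (LV Lkx) Ex; rewrite invgM invgK mulgA mulgV mul1g.
Qed.

(** The preimage in [G] of the quasi-component of the identity in S / L. *)
Let I := [set x | forall E, quasi E -> E x].

(** In a compact Hausdorff space quasi-components are connected. Here A and B are closed and
    saturated, because each coset of L is connected and stays in one piece; disjoint open saturated
    neighbourhoods of them yield a quasi set that excludes b. *)
Lemma quasi_component_split A B : A `|` B = I -> separated A B -> A 1 ->
  B !=set0 -> False.
Proof.
move=> AB sAB A1 [b Bb].
have AI : A `<=` I by rewrite -AB; exact: subsetUl.
have BI : B `<=` I by rewrite -AB; exact: subsetUr.
have IS : I `<=` S by move=> x Ix; exact: Ix quasiS.
have cI : closed I.
  have -> : I = \bigcap_(E in quasi) E by apply/seteqP; split.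
  by apply: closed_bigI => E [].
have sI : saturated I by move=> x l Ll Ix E qE; case: (qE) => _ sE _ _ _; exact: sE (Ix E qE).
have dAB : A `&` B = set0 by exact: separated_disjoint.
have coset x : I x -> A x /\ (forall l, L l -> A (x * l)) \/
                      B x /\ (forall l, L l -> B (x * l)).
  move=> Ix; pose C := [set x * l * 1 | l in L].
  have Cx : C x by exists 1 => //; rewrite !mulg1.
  have [||CA|CB] := @connected_subset _ _ _ C sAB.
  - by rewrite AB => _ [l Ll <-]; rewrite mulg1; exact: sI.
  - by apply: connected_conj; exact: component_connected.
  - left; split=> [|l Ll]; first exact: CA.
    by apply: CA; exists l => //; rewrite mulg1.
  - right; split=> [|l Ll]; first exact: CB.
    by apply: CB; exists l => //; rewrite mulg1.
have notAB x : A x -> B x -> False.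
  by move=> Ax Bx; have : (A `&` B) x by []; rewrite dAB.
have sA : saturated A.
  move=> x l Ll Ax; have [[_ /(_ l Ll)//]|[Bx _]] := coset x (AI _ Ax).
  by case: (notAB x).
have sB : saturated B.
  move=> x l Ll Bx; have [[Ax _]|[_ /(_ l Ll)//]] := coset x (BI _ Bx).
  by case: (notAB x).
have [clAB ABcl] := sAB.
have cA : closed A.
  move=> x clAx; have : I x by apply: cI; exact: closureS clAx.
  rewrite -AB => -[//|Bx].
  by have : (closure A `&` B) x by []; rewrite clAB.
have cB : closed B.
  move=> x clBx; have : I x by apply: cI; exact: closureS clBx.
  rewrite -AB => -[Ax|//].
  by have : (A `&` closure B) x by []; rewrite ABcl.
have nA : \forall v \near (1 : G), forall x, A x -> (~` B) (x * v).
  apply: tube; [exact: cA|exact: sA|by move=> x /AI/IS|exact: closed_openC|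
    exact: saturatedC|by move=> x Ax; exact: notAB].
(* The set [W] is chosen so that y p = z q is impossible for y in A, z in B and p, q in [W]: it
   would put y p q^-1 = z in B, against [nA]. *)
have : (fun p : G * G => p.1 * p.2^-1) @ ((1 : G), (1 : G)) --> (1 : G) * 1^-1.
  by apply: cvg_mulg; [exact: cvg_fst|apply: cvg_invg; exact: cvg_snd].
rewrite mulgV => /(_ _ nA) [[P Q] /= [nP nQ] PQ].
pose W := (P `&` Q)^°.
have oW : open W by exact: open_interior.
have W1 : W 1 by exact: filterI.
have UAB x : thicken A W x -> thicken B W x -> False.
  move=> [y Ay /interior_subset [Py _]] [z Bz /interior_subset [_ Qz]].
  have /= /(_ y Ay) := PQ (y^-1 * x, z^-1 * x) (conj Py Qz).
  by rewrite invgM invgK mulgA mulVKg mulgA mulgV mul1g.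
have oA := thicken_open A oW; have oB := thicken_open B oW.
(* Points of S outside both thickenings are outside I, so some quasi set E lies in their union. *)
have [|||x [Sx]|E qE ED] := @quasi_avoid (S `\` (thicken A W `|` thicken B W)).
- by apply: closedI; [exact: closedS|apply: open_closedC; exact: openU].
- apply: saturatedI; first exact: saturatedS.
  by apply: saturatedC; apply: saturatedU; exact: thicken_saturated.
- by move=> x [].
- move=> nABx; apply: contrapT => nE; apply: nABx.
  have : I x by move=> E qE; apply: contrapT => nEx; apply: nE; exists E.
  by rewrite -AB => -[Ax|Bx]; [left|right]; exact: sub_thicken.
case: (qE) => E1 sE cE ES cSE.
have EAB x : E x -> thicken A W x \/ thicken B W x.
  move=> Ex; apply: contrapT => nx; apply: (ED x Ex); split=> //.
  exact: ES.
(* Hence the part of E in [thicken A W] is closed as well as relatively open: it is a quasi set, yet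
   it misses b. *)
have EA : E `&` thicken A W = E `&` ~` thicken B W.
  apply/seteqP; split=> x [Ex UAx]; split=> //.
    by move=> /UAB; apply.
  by have [|/UAx] := EAB x Ex.
have /BI/(_ (E `&` thicken A W)) : B b by [].
case=> [|_ /UAB]; last by apply; exact: sub_thicken.
split=> //.
- by split=> //; exact: sub_thicken.
- by apply: saturatedI => //; exact: thicken_saturated.
- by rewrite EA; apply: closedI => //; exact: open_closedC.
- by move=> x [/ES].
- have -> : S `\` (E `&` thicken A W) = (S `\` E) `|` (E `&` ~` thicken A W).
    apply/seteqP; split=> x.
      move=> [Sx nEA]; have [Ex|nEx] := pselect (E x); last by left.
      by right; split=> // UAx; apply: nEA.
    by move=> [[Sx nEx]|[Ex nUA]]; split=> //; [case|exact: ES|case].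
  by apply: closedU => //; apply: closedI => //; exact: open_closedC.
Qed.

Lemma quasi_component_sub : I `<=` L.
Proof.
have I1 : I 1 by move=> E [].
apply: (connected_component_max I1) => //; apply: contrapT.
move=> /connectedPn [E [E0 IE sE]].
have : I 1 by []; rewrite IE => -[E1|E1].
  exact: (quasi_component_split (esym IE) sE E1 (E0 true)).
rewrite setUC in IE; rewrite separatedC in sE.
exact: (quasi_component_split (esym IE) sE E1 (E0 false)).
Qed.

(** With O the saturation of the interior of [K], the quasi-component lies in L and so in O. Some
    quasi set E therefore avoids S minus O, and being relatively open in S and contained in O it is
    open in [G]. *)
Lemma quasi_open : exists2 E, quasi E & open E.
Proof.
pose O := [set x | exists2 k, K^° k & L (k^-1 * x)].
have OS : O `<=` S by move=> x [k /interior_subset Kk Lkx]; exists k.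
have sO : saturated O.
  by move=> x l Ll [k Kk Lx]; exists k => //; rewrite mulgA; exact: LM.
have oO : open O.
  rewrite openE => x [k Kk Lkx]; rewrite /interior /=.
  have xk : (fun z => z * (x^-1 * k) : G) @ x --> x * (x^-1 * k).
    by apply: cvg_mulg; [exact: cvg_id|exact: cvg_cst].
  have : \forall z \near x, K^° (z * (x^-1 * k)).
    apply: xk; rewrite mulVKg; apply: open_nbhs_nbhs.
    by split=> //; exact: open_interior.
  apply: filterS => z Kz; exists (z * (x^-1 * k)); first exact: Kz.
  by rewrite !invgM !invgK mulgVK.
have [|||x [Sx nOx]|E qE ED] := @quasi_avoid (S `\` O).
- by apply: closedI; [exact: closedS|exact: open_closedC].
- by apply: saturatedI; [exact: saturatedS|exact: saturatedC].
- by move=> x [].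
- apply: contrapT => nE; apply: nOx; exists 1; first exact: nK.
  rewrite invg1 mul1g; apply: quasi_component_sub => E qE.
  by apply: contrapT => nEx; apply: nE; exists E.
exists E => //; case: (qE) => E1 sE cE ES cSE.
have -> : E = O `&` ~` (S `\` E).
  apply/seteqP; split=> x.
    move=> Ex; split; last by case.
    by apply: contrapT => nOx; apply: (ED x Ex); split=> //; exact: ES.
  by move=> [Ox nSE]; apply: contrapT => nEx; apply: nSE; split=> //; exact: OS.
by apply: openI => //; exact: closed_openC.
Qed.

Lemma open_subgroup_mod_component : exists N : set G, [/\ is_subgroup N, open N &
  forall x, N x -> exists2 k, K k & L (k^-1 * x)].
Proof.
have [E [E1 sE cE ES _] oE] := quasi_open.
(* N is the stabiliser of E under right translation. It lies in E since 1 does, and is a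
   neighbourhood of 1 by the tube lemma with A = O = E. *)
pose N := [set g | forall x, E x -> E (x * g) /\ E (x * g^-1)].
have gN : is_subgroup N.
  split=> [x Ex|g h Ng Nh x Ex|g Ng x Ex]; first by rewrite invg1 mulg1.
    have [Eg Eg'] := Ng x Ex; have [Eh Eh'] := Nh x Ex.
    by rewrite invgM !mulgA; split; [case: (Nh _ Eg)|case: (Ng _ Eh')].
  by rewrite invgK; have [] := Ng x Ex.
exists N; split=> //; last first.
  by move=> x Nx; apply: ES; have [] := Nx 1 E1; rewrite mul1g.
apply: open_subgroup => //.
have nE := tube cE sE ES oE sE (@subset_refl _ E).
have := @invg_continuous G 1; rewrite /continuous_at invg1 => /(_ _ nE) nE'.
by apply: filterS2 nE nE' => v Ev Ev' x Ex; split; [exact: Ev|exact: Ev'].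
Qed.

End OpenAlmostConnectedSubgroup.

(** * Translation of components, and their openness in Lie groups *)

Lemma connected_component_mulg (G : topologicalGroupType) (x y : G) :
  identity_component [set: G] (x^-1 * y) ->
  connected_component [set: G] x = connected_component [set: G] y.
Proof.
move=> Lxy; apply: same_connected_component.
pose C := [set x * z * 1 | z in identity_component [set: G]].
have Cx : C x.
  by exists 1; [exact: connected_component_refl|rewrite !mulg1].
apply: (connected_component_max Cx) => //.
  by apply: connected_conj; exact: component_connected.
by exists (x^-1 * y) => //; rewrite mulg1 mulVKg.
Qed.

(** The inverse of a chart at 1 sends segments issuing from [c 1] inside a ball to connected sets
    through 1, so the component contains a neighbourhood of 1. *)
Lemma identity_component_open (R : realType) (G : topologicalGroupType) n
    (A : set (chart R G n)) :
  smooth_atlas A -> open (identity_component [set: G]).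
Proof.
move=> [chA covA _]; apply: open_subgroup; first exact: identity_component_subgroup.
have [c Ac c1] := covA 1; have [od oi cK] := chA c Ac.
rewrite continuous_open_subspace // continuous_open_subspace // => cc ci.
have img1 : chart_img c (c 1) by exists 1.
have /nbhs_ballP [e /= e0 eU] : nbhs (c 1) (chart_img c) by exact: open_nbhs_nbhs.
have Lball (z : 'rV[R]_n) : ball (c 1) e z -> identity_component [set: G] (chart_inv c z).
  rewrite -ball_normE /ball_ /= => ze.
  pose p (t : R) : 'rV[R]_n := (c 1%g + t *: (z - c 1%g))%R.
  have pU t : `[0%R, 1%R]%classic t -> chart_img c (p t).
    rewrite /= in_itv /= => /andP[t0 t1]; apply: eU; rewrite -ball_normE /ball_ /=.
    rewrite /p opprD addNKr normrN normrZ ger0_norm //.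
    apply: le_lt_trans ze; rewrite distrC -[leRHS]mul1r.
    by apply: ler_wpM2r.
  have cp : {within `[0%R, 1%R]%classic, continuous (chart_inv c \o p)}.
    apply: continuous_in_subspaceT => t /set_mem t01.
    apply: continuous_comp; last by apply: ci; rewrite inE; exact: pU.
    apply: cvgD; first exact: cvg_cst.
    by apply: cvgZr_tmp; exact: cvg_id.
  have := connected_continuous_connected (@segment_connected R 0%R 1%R) cp.
  set C := _ @` _ => cC.
  have C1 : C 1.
    exists 0%R; first by rewrite /= in_itv /= lexx ler01.
    by rewrite /p /= scale0r addr0 cK.
  apply: (connected_component_max C1) => //; exists 1%R.
    by rewrite /= in_itv /= lexx ler01.
  by rewrite /p /= scale1r addrC subrK.
have /(_ _ (nbhsx_ballx (c 1) e e0)) cball : c @ 1 --> c 1.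
  by apply: cc; rewrite inE.
have n1 : nbhs 1 (chart_dom c) by exact: open_nbhs_nbhs.
by apply: filterS2 n1 cball => x cx /Lball; rewrite cK.
Qed.

(** * Ergodicity: recurrence, and the obstruction from open subgroups *)

(** An isolated point would, by translation, make [X] discrete, and a compact discrete space is
    finite. *)
Lemma open_not_subsingleton (X : topologicalGroupType) (A : set X) x :
  infinite_set [set: X] -> compact [set: X] -> open A -> A x ->
  exists2 y, A y & x != y.
Proof.
move=> infX cX oA Ax; apply: contrapT => nA; apply: infX.
have Ax1 (y : X) : A y -> y = x.
  by move=> Ay; apply: contrapT => /eqP; rewrite eq_sym => xy; apply: nA; exists y.
have open1 (y : X) : open [set y].
  have -> : [set y] = [set z | A (x * y^-1 * z)].
    apply/seteqP; split=> z /=; first by move=> ->; rewrite mulgVK.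
    by move=> /Ax1 /(congr1 (fun t => y * x^-1 * t)); rewrite !mulgA !mulgVK mulgV mul1g.
  apply: open_comp => // z _; apply: cvg_mulg; [exact: cvg_cst|exact: cvg_id].
(* The filter of sets t containing a given finite set: covering [X] by eventual membership in t
   forces [X] into a finite set. *)
have FF : Filter (filter_from (@finite_set X) (fun s => [set t | s `<=` t])).
  apply: filter_from_filter; first by exists set0; exact: finite_set0.
  move=> s t fs ft; exists (s `|` t); first by rewrite finite_setU.
  by move=> u; rewrite /= subUset.
have /compact_near_coveringP/(_ _ _ (fun (t : set X) y => t y) FF) := cX.
case=> [y _|s fs sX]; last by apply: sub_finite_set fs; exact: sX.
exists ([set y], [set t | [set y] `<=` t]).
  split; first by apply: open_nbhs_nbhs; split=> //; exact: open1.
  by exists [set y] => //; exact: finite_set1.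
by move=> [_ t] /= [-> /(_ y erefl)].
Qed.

(** Inside O two boxes with disjoint bases are chosen; ergodicity carries one to the other, and
    disjointness excludes time 0. *)
Lemma ergodic_recurrent (X G : topologicalGroupType) (a : X) (f : X -> G) :
  hausdorff_space X -> infinite_set [set: X] -> compact [set: X] ->
  ergodic (rotation a) f -> recurrent (rotation a) f.
Proof.
move=> hX infX cX erg O oO [[x g] Oxg].
have [[A B] /= [nA nB] AB] : nbhs (x, g) O by exact: open_nbhs_nbhs.
have [y Ay xy] := open_not_subsingleton infX cX (@open_interior _ A) nA.
move: hX; rewrite open_hausdorff => /(_ _ _ xy) [[U V] /= [Ux Vy] [oU oV UV]].
have oX (C : set X) (D : set G) : open C -> open D -> open (C `*` D).
  move=> oC oD; rewrite openE => -[z h] [Cz Dh]; exists (C, D) => //.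
  by split; exact: open_nbhs_nbhs.
have [||||n [_ [[[z h] [[/= Az Uz] Bh] <-]] [[Anz Vnz] Bnh]]] :=
  erg ((A^° `&` U) `*` B^°) ((A^° `&` V) `*` B^°).
- by apply: oX; [apply: openI => //|]; exact: open_interior.
- by exists (x, g); split=> //; split=> //; rewrite -inE.
- by apply: oX; [apply: openI => //|]; exact: open_interior.
- by exists (y, g); split=> //; split=> //; rewrite -inE.
exists n.
  apply/eqP => n0; have : (U `&` V) z.
    by split=> //; move: Vnz; rewrite n0 /= /rotation /= mul1g.
  by rewrite (eqP UV).
exists (skew_product (rotation a) f n (z, h)); split.
  by exists (z, h) => //; apply: AB; split; exact: interior_subset.
by apply: AB; split; exact: interior_subset.
Qed.

Section CohomologousErgodic.
Context (X G : topologicalGroupType) (a : X) (f b : X -> G) (H : set G).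
Hypotheses (gH : is_subgroup H) (oH : open H) (cb : continuous b).
Hypothesis bH : forall x, H ((b (rotation a 1 x))^-1 * f x * b x).

Lemma cohomologous_cocycle n x :
  H ((b (rotation a n x))^-1 * cocycle (rotation a) f n x * b x).
Proof.
have [H1 HM HV] := gH.
have Hnat m y : H ((b (a ^+ m * y))^-1 * cocycle_nat (rotation a) f m y * b y).
  elim: m => [|m IHm]; first by rewrite /= mul1g mulg1 mulVg.
  have := HM _ _ (bH (a ^+ m * y)) IHm.
  have -> : rotation a 1 (a ^+ m * y) = a ^+ m.+1 * y.
    by rewrite /rotation /= expg1 expgS mulgA.
  by rewrite !mulgA mulgK -[_ * f _ * _]mulgA.
case: n => m; first exact: Hnat.
have := HV _ (Hnat m.+1 (rotation a (Negz m) x)).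
have -> : a ^+ m.+1 * rotation a (Negz m) x = x by rewrite /rotation /= mulVKg.
rewrite /cocycle; move: (cocycle_nat _ _ _ _) => c.
by rewrite 2!invgM invgK mulgA.
Qed.

(** The map (x, g) -> b(x)^-1 g changes along the skew product by left factors in H. The preimages
    of H and of its complement are thus invariant, and both are open, so the second must be
    empty. *)
Lemma ergodic_subgroup : ergodic (rotation a) f -> H = setT.
Proof.
move=> erg; have [H1 HM HV] := gH.
apply/seteqP; split=> // g _; apply: contrapT => nHg.
pose p (z : X * G) := (b z.1)^-1 * z.2.
have cp : continuous p.
  move=> [x h]; apply: cvg_mulg; last exact: cvg_snd.
  by apply: cvg_invg; apply: (@continuous_cvg _ X G _ _ fst b); [exact: cb|exact: cvg_fst].
have [||||n [_ [[[x h] Hp <-]]]] := erg (p @^-1` H) (p @^-1` (~` H)).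
- by apply: open_comp => // z _; exact: cp.
- by exists (1, b 1); rewrite /p /= mulVg.
- apply: open_comp => [z _|]; first exact: cp.
  by apply: closed_openC; exact: open_subgroup_closed.
- by exists (1, b 1 * g); rewrite /p /= mulKg.
apply; have := HM _ _ (cohomologous_cocycle n x) Hp.
by rewrite /p /= !mulgA mulgK.
Qed.

End CohomologousErgodic.

(** * Almost connectedness of the target group *)

Section AlmostConnected.
Context (X G : topologicalGroupType) (a : X) (f : X -> G) (N : set G).
Hypotheses (X_compact : compact [set: X]) (a_dense : dense (range (expgz a))).
Hypotheses (N_group : is_subgroup N) (nN : normalized N) (oN : open N).
Hypotheses (cf : continuous f) (rf : recurrent (rotation a) f).
Local Notation H := (return_group a f N).

Lemma return_group_open : open H.
Proof.
apply: open_subgroup; first exact: return_group_subgroup.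
apply: (@filterS _ _ _ N); first exact: return_group_sup.
by apply: open_nbhs_nbhs; split=> //; case: N_group.
Qed.

Lemma return_group_almost_connected K : compact K ->
  (forall x, N x -> exists2 k, K k & identity_component [set: G] (k^-1 * x)) ->
  almost_connected H.
Proof.
move=> cK NK; have gH : is_subgroup H by exact: return_group_subgroup.
have [N1 _ _] := N_group; have [_ HM HV] := gH.
have cN := open_subgroup_closed N_group oN.
have LH : identity_component [set: G] `<=` H.
  apply: (@subset_trans _ N); last exact: return_group_sup.
  exact: identity_component_sub_clopen.
have [n Hn] := return_group_finite X_compact N_group nN oN cf rf.
pose F j := cocycle_nat (rotation a) f j 1.
(* H is a finite union of cosets [F i] N, and N lies in K L. As [K] need not lie in N, the compact
   set is cut down to H afterwards. *)
pose K' := \bigcup_(i < n) [set F i * k | k in K].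
apply: (@almost_connected_compact _ _ (K' `&` H)) => //.
- apply: compact_closedI; last exact: open_subgroup_closed return_group_open.
  rewrite /K' bigcup_mkord; apply: bigsetU_compact => i _.
  apply: continuous_compact => //; apply: continuous_subspaceT => k.
  by apply: cvg_mulg; [exact: cvg_cst|exact: cvg_id].
move=> h Hh; have [i ltin Nih] := Hn h Hh; have [k Kk Lk] := NK _ Nih.
have {}Lk : identity_component [set: G] ((F i * k)^-1 * h).
  by rewrite invgM -mulgA.
exists (F i * k); last by rewrite identity_component_sub.
split; first by exists i => //; exists k.
have -> : F i * k = h * ((F i * k)^-1 * h)^-1.
  by rewrite invgM invgK mulgA mulgV mul1g.
by apply: HM => //; apply: HV; exact: LH.
Qed.

Lemma cohomologous_almost_connected K : compact K ->
  (forall x, N x -> exists2 k, K k & identity_component [set: G] (k^-1 * x)) ->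
  exists (H : set G) (f' : X -> G),
       [/\ is_subgroup H, closed H, almost_connected H,
           continuous f' & cohomologous (rotation a) f f' /\ forall x, H (f' x)].
Proof.
move=> cK NK; pose b := transfer a f N.
have cb : continuous b by exact: transfer_continuous.
exists H, (fun x => (b (rotation a 1 x))^-1 * f x * b x); split.
- exact: return_group_subgroup.
- by apply: open_subgroup_closed; [exact: return_group_subgroup|exact: return_group_open].
- exact: return_group_almost_connected cK NK.
- move=> x; apply: cvg_mulg; last exact: cb.
  apply: cvg_mulg; last exact: cf.
  apply: cvg_invg; apply: (@continuous_cvg _ X G _ _ (rotation a 1) b); first exact: cb.
  by apply: cvg_mulg; [exact: cvg_cst|exact: cvg_id].
- split; first by exists b.
  by move=> x; exact: transferP.
Qed.

End AlmostConnected.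

Theorem corollary3p4 (R : realType) (X : topologicalGroupType) (a : X)
    (X_infinite : infinite_set [set: X])
    (X_compact : compact [set: X])
    (X_metrizable : metrizable R X)
    (a_minimal : dense (range (expgz a))) :
  (forall G : topologicalGroupType,
     lie_group R G \/ lcsc_abelian G ->
     forall f : X -> G, continuous f -> recurrent (rotation a) f ->
     exists (H : set G) (f' : X -> G),
       [/\ is_subgroup H, closed H, almost_connected H,
           continuous f' & cohomologous (rotation a) f f' /\ forall x, H (f' x)])
  /\
  (forall G : topologicalGroupType,
     lie_group R G -> infinitely_many_components G ->
     ~ exists f : X -> G, continuous f /\ ergodic (rotation a) f).
Proof.
have hX : hausdorff_space X.
  have [M [h [k [hk kh ch _]]]] := X_metrizable.
  rewrite open_hausdorff => x y xy.
  have oh (C : set M) : open C -> open (h @^-1` C).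
    by move=> oC; apply: open_comp => // z _; exact: ch.
  have hxy : h x != h y by apply: contraNneq xy => /(can_inj hk) ->.
  have := @metric_hausdorff R M; rewrite open_hausdorff => /(_ _ _ hxy).
  move=> [[U V] /= [Ux Vy] [oU oV UV]]; exists (h @^-1` U, h @^-1` V) => /=.
    by split; apply/mem_set => /=; exact/set_mem.
  by split; [exact: oh|exact: oh|
    rewrite -preimage_setI (eqP UV) preimage_set0].
split=> [G [[_ _ [n [A [atlas _ _]]]]|[_ lcG _ abG]] f cf rf|].
(* Lie case: N is the identity component, and the compact set of representatives is the singleton of
   1. *)
- apply: (@cohomologous_almost_connected _ _ a f (identity_component [set: G]) _ _ _ _ _ _ _ [set 1]) => //.
  + exact: identity_component_subgroup.
  + exact: identity_component_normalized.
  + exact: identity_component_open atlas.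
  + exact: compact_set1.
  + by move=> x Lx; exists 1 => //; rewrite invg1 mul1g.
- have [K] := lcG 1 I; rewrite withinET => K1 [cK _].
  have [N [gN oN NK]] := open_subgroup_mod_component cK K1.
  apply: (cohomologous_almost_connected _ _ gN _ oN _ _ cK NK) => // g x Nx.
  by rewrite abG mulgA mulgV mul1g.
move=> G [_ _ [n [A [atlas _ _]]]] infG [f [cf erg]].
have rf := ergodic_recurrent hX X_infinite X_compact erg.
have gL := @identity_component_subgroup G setT (And3 I (fun _ _ _ _ => I) (fun _ _ => I)).
have nL := @identity_component_normalized G.
have oL := identity_component_open atlas.
have [m Hm] := return_group_finite X_compact gL nL oL cf rf.
have HT : return_group a f (identity_component [set: G]) = setT.
  apply: (@ergodic_subgroup X G a f (transfer a f (identity_component [set: G]))) => //.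
  - exact: return_group_subgroup.
  - exact: return_group_open.
  - exact: transfer_continuous.
  - by move=> x; exact: transferP.
(* As H is all of [G], every g is congruent modulo the identity component to some [F i] with i < m,
   which bounds the components by m. *)
apply: infG; apply: (@sub_finite_set _ _
  ((fun i => connected_component [set: G] (cocycle_nat (rotation a) f i 1)) @` `I_m)).
  move=> _ [g _ <-]; have [|i im Lig] := Hm g; first by rewrite HT.
  by exists i => //; exact: connected_component_mulg.
exact/finite_image/finite_II.
Qed.
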